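(* Let $D_{2n}$ be the dihedral group of order $2n$. Then $$\beta(\mathcal{P}_{D_{2n}})=\beta(\mathcal{P}_{Z_n})+n-2,$$ where $Z_n$ is a cyclic group of order $n$.
   Context: The (undirected) power graph $\mathcal{P}_G$ of a finite group $G$ is the simple graph whose vertices are the elements of $G$, with an edge between two distinct vertices $x$ and $y$ if either $x^m=y$ or $y^m=x$ for some positive integer $m$; it is always connected. The dihedral group is presented as $D_{2n}=\langle a,b\mid a^n=b^2=e,\ (ab)^2=e\rangle$. For a finite, simple, connected graph $\Gamma$ with vertex set $V(\Gamma)$, $d_\Gamma(u,v)$ denotes the length of a shortest path between $u$ and $v$. An ordered set $W=\{w_1,\dots,w_k\}$ of vertices of $\Gamma$ is a resolving set if distinct vertices $v$ of $\Gamma$ have distinct representations $(d_\Gamma(v,w_1),\dots,d_\Gamma(v,w_k))$. The metric dimension $\beta(\Gamma)$ is the minimum cardinality of a resolving set of $\Gamma$.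
   Formalization: The identity is proved for n ≥ 3; it fails for n = 1 (left side 1, right side at most 0) and for n = 2 (D_4 is the Klein four-group with power graph K_{1,3}, so the left side is 2 and the right side is 1). *)

(* Defs.v *)
From mathcomp Require Import all_boot all_fingroup all_solvable.

Set Implicit Arguments.
Unset Strict Implicit.
Unset Printing Implicit Defensive.

Import GroupScope.

Section MetricDimension.

Variables (T : finType) (e : rel T).

(* A shortest path has fewer than #|T| edges; the value is #|T| when u and v
   are not connected (see [gdistP] and [gdist_ltn]). *)
Definition gdist (u v : T) : nat :=
  find (fun k => [exists p : k.-tuple T, path e u p && (last u p == v)])
    (iota 0 #|T|).

Lemma gdistP (u v : T) : connect e u v ->
  (exists p, [/\ path e u p, last u p = v & size p = gdist u v]) /\
  (forall p, path e u p -> last u p = v -> gdist u v <= size p).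
Proof.
move=> /connectP[p0 pth0 lst0].
set a := fun k => [exists p : k.-tuple T, path e u p && (last u p == v)].
have aP p : path e u p -> last u p = v -> a (size p).
  move=> pp lp; apply/existsP; exists (in_tuple p).
  by rewrite /= pp lp eqxx.
have has_a : has a (iota 0 #|T|).
  case: (shortenP pth0) lst0 => p pp up _ lp.
  apply/hasP; exists (size p); last by apply: aP.
  rewrite mem_iota add0n /=.
  by have := max_card [in u :: p]; rewrite (card_uniqP up).
split.
  have := nth_find 0 has_a; rewrite nth_iota; last first.
    by rewrite -[X in _ < X](size_iota 0) -has_find.
  rewrite add0n => /existsP[p /andP[pp /eqP lp]].
  by exists p; rewrite size_tuple.
move=> p pp lp; rewrite leqNgt; apply/negP => lt_p.
have lt_pT : size p < #|T|.
  apply: leq_trans lt_p _.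
  by rewrite -[X in _ <= X](size_iota 0); apply: find_size.
have /negP[] := negbT (before_find 0 lt_p).
by rewrite nth_iota // add0n; apply: aP.
Qed.

Lemma gdist_ltn (u v : T) : (gdist u v < #|T|) = connect e u v.
Proof.
set a := fun k => [exists p : k.-tuple T, path e u p && (last u p == v)].
have -> : (gdist u v < #|T|) = has a (iota 0 #|T|).
  by rewrite has_find size_iota.
apply/idP/idP => [/hasP[k _ /existsP[p /andP[pp /eqP lp]]]|].
  by apply/connectP; exists p.
case/connectP=> p0 pth0; case: (shortenP pth0) => p pp up _ lp.
apply/hasP; exists (size p).
  rewrite mem_iota add0n /=.
  by have := max_card [in u :: p]; rewrite (card_uniqP up).
by apply/existsP; exists (in_tuple p); rewrite /= pp lp eqxx.
Qed.

Lemma gdist_eq0 (u v : T) : (gdist u v == 0) = (u == v).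
Proof.
apply/eqP/eqP => [d0|->].
  have T0 : 0 < #|T| by apply/card_gt0P; exists u.
  have /gdistP[[p [_ lp sp]] _] : connect e u v by rewrite -gdist_ltn d0.
  by move: lp; rewrite (size0nil (etrans sp d0)).
have [_ /(_ [::] isT erefl)] := gdistP (connect0 e v).
by rewrite leqn0 => /eqP.
Qed.

(* The vertices of W are ordered by their position in [enum W]; the order does
   not matter for resolvability. *)
Definition representation (W : {set T}) (v : T) : seq nat :=
  [seq gdist v w | w <- enum W].

Definition resolving (W : {set T}) : bool := injectiveb (representation W).

Lemma resolving_setT : resolving [set: T].
Proof.
apply/injectiveP => u v /eq_in_map eq_uv.
have := eq_uv u; rewrite mem_enum inE => /(_ isT).
rewrite (eqP (_ : gdist u u == 0)) ?gdist_eq0 // => /esym/eqP.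
by rewrite gdist_eq0 => /eqP.
Qed.

Definition metric_dim : nat := #|[arg min_(W < [set: T] | resolving W) #|W| ]|.

Lemma metric_dimP :
  (exists2 W, resolving W & #|W| = metric_dim) /\
  (forall W, resolving W -> metric_dim <= #|W|).
Proof.
rewrite /metric_dim; case: arg_minnP => [|W resW minW].
  exact: resolving_setT.
by split=> //; exists W.
Qed.

End MetricDimension.

(* The exponents 1, ..., #|gT| realize all positive powers of an element. *)
Definition power_graph (gT : finGroupType) : rel gT := fun x y =>
  (x != y) && ([exists m : 'I_#|gT|, x ^+ m.+1 == y]
               || [exists m : 'I_#|gT|, y ^+ m.+1 == x]).
Arguments power_graph : clear implicits.

Section PowerGraph.

Variable gT : finGroupType.
Implicit Types x y : gT.

Lemma pos_powerP x y :
  reflect (exists m, 0 < m /\ x ^+ m = y) [exists m : 'I_#|gT|, x ^+ m.+1 == y].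
Proof.
apply: (iffP existsP) => [[m /eqP <-]|[[|m] [] // _ <-]]; first by exists m.+1.
have lt_m : m %% #[x] < #|gT|.
  apply: leq_trans (ltn_pmod m (order_gt0 x)) _.
  by rewrite orderE max_card.
exists (Ordinal lt_m) => /=.
by rewrite !expgS expg_mod_order.
Qed.

Lemma power_graphP x y :
  reflect (x <> y /\ ((exists m, 0 < m /\ x ^+ m = y) \/
                      (exists m, 0 < m /\ y ^+ m = x)))
          (power_graph gT x y).
Proof.
apply: (iffP andP) => [[/eqP ne /orP h]|[/eqP ne h]].
  by split=> //; case: h => /pos_powerP; [left|right].
by split=> //; apply/orP; case: h => /pos_powerP; [left|right].
Qed.

Lemma power_graph_irr : irreflexive (power_graph gT).
Proof. by move=> x; rewrite /power_graph eqxx. Qed.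

Lemma power_graph_sym : symmetric (power_graph gT).
Proof. by move=> x y; rewrite /power_graph eq_sym orbC. Qed.

Lemma power_graph_connected x y : connect (power_graph gT) x y.
Proof.
have c1 z : connect (power_graph gT) z 1.
  have [->|/eqP z1] := eqVneq z 1; first exact: connect0.
  apply/connect1/power_graphP; split=> //; left; exists #[z].
  by rewrite order_gt0 expg_order.
apply: connect_trans (c1 x) _.
by rewrite (sym_connect_sym power_graph_sym).
Qed.

End PowerGraph.

Lemma dihedral_presentation n : 1 < n ->
  'D_(2 * n)%N \isog Grp (a : b : a ^+ n, b ^+ 2, (a * b) ^+ 2).
Proof.
move=> n1 rT H; rewrite mul2n Grp_dihedral //.
have key (x y : rT) : y ^+ 2 = 1 -> ((x * y) ^+ 2 == 1) = (x ^ y == x^-1).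
  move=> y2; have yV : y^-1 = y by apply/eqP; rewrite eq_invg_mul -expg2 y2.
  by rewrite expg2 -!mulgA -eq_invg_mul eq_sym conjgE yV.
apply/existsP/existsP => -[[x y]] /=; rewrite !xpair_eqE.
  by case/and4P=> dH xn /eqP y2 xy; exists (x, y);
     rewrite /= !xpair_eqE dH xn y2 key // xy eqxx.
by case/and4P=> dH xn /eqP y2 xy; exists (x, y);
   rewrite /= !xpair_eqE dH xn y2 -key // xy eqxx.
Qed.

(* Main.v *)
Require Import Defs.
From mathcomp Require Import all_boot all_fingroup all_solvable zify.

Set Implicit Arguments.
Unset Strict Implicit.
Unset Printing Implicit Defensive.

Import GroupScope.

(** In the power graph of the dihedral group the rotations induce a copy of
  the power graph of the cyclic group of order n, and each of the n
  reflections, being an involution that is a power of no other element, hangs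
  from the identity as a pendant vertex ([dihedral_rotations],
  [power_graph_pendant]).  The identity is adjacent to everything, so every
  distance is at most 2 and the theorem becomes a statement about a graph with
  a universal vertex c to which pendant vertices are attached
  ([metric_dim_pendants]).

  Pendants are pairwise twins, so a resolving set contains all of them but at
  most one.  Being equidistant from all the old vertices other than c, they
  help the old vertices only by isolating c, which is exactly what c
  itself does in the old graph.  So the old vertices of a resolving set of the
  big graph, together with c, resolve the old graph; conversely, in a
  resolving set of the old graph that contains c, one may trade c for all
  the pendants but one.  The net change is n - 1 pendants minus the vertex
  c.

  Two points need the other universal vertices of the cyclic power graph,
  namely a generator and its inverse, which differ because n > 2.  They are
  twins of c, so a minimum resolving set can be made to contain c
  ([universal_in_min_resolving]); and they are twins of each other, so one of
  them is always selected, and it separates the last pendant, which is at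
  distance 2 from it, from the old vertices, which are at distance at most
  1. *)

(** * Resolving sets and twins *)

Section Resolving.

Context {T : finType} {e : rel T}.
Implicit Types (u v w : T) (W : {set T}).

Lemma resolvingP W :
  reflect (forall u v, {in W, forall w, gdist e u w = gdist e v w} -> u = v)
          (resolving e W).
Proof.
apply: (iffP (injectiveP _)) => resW u v eq_uv; apply: resW.
  by apply/eq_in_map=> w; rewrite mem_enum; apply: eq_uv.
by move=> w Ww; move/eq_in_map: eq_uv; apply; rewrite mem_enum.
Qed.

Lemma resolving_imset (s : T -> T) W :
  bijective s -> (forall u v, gdist e (s u) (s v) = gdist e u v) ->
  resolving e W -> resolving e (s @: W).
Proof.
case=> s' sK s'K iso_s /resolvingP resW; apply/resolvingP=> u v eq_uv.
rewrite -[u]s'K -[v]s'K; congr s; apply: resW => w Ww.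
by rewrite -!(iso_s _ w) !s'K; apply/eq_uv/imset_f.
Qed.

Lemma twin_in_resolving W u v :
  (forall w, w != u -> w != v -> gdist e u w = gdist e v w) ->
  u != v -> resolving e W -> (u \in W) || (v \in W).
Proof.
move=> twin_uv neq_uv /resolvingP resW; apply: contraR neq_uv.
rewrite negb_or => /andP[Wu Wv]; apply/eqP/resW => w Ww.
by apply: twin_uv; [apply: contraNneq Wu | apply: contraNneq Wv] => <-.
Qed.

End Resolving.

(** * Graphs with a universal vertex *)

Section Universal.

Context {T : finType} {e : rel T}.
Hypothesis e_sym : symmetric e.
Implicit Types (u v w : T) (W : {set T}).

Definition universal u := forall v, v != u -> e u v.

Context {c : T} (univ_c : universal c).

(** Any two vertices are joined through [c], so the graph has diameter at
  most 2 and distances are a function of equality and adjacency. *)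
Lemma gdist_universal u v :
  gdist e u v = (if u == v then 0 else if e u v then 1 else 2)%N.
Proof.
have [<-|neq_uv] := eqVneq; first by apply/eqP; rewrite gdist_eq0.
have d_gt0 : 0 < gdist e u v by rewrite lt0n gdist_eq0.
have conn_c w : connect e w c.
  have [->|neq_wc] := eqVneq w c; first exact: connect0.
  by apply: connect1; rewrite e_sym; apply: univ_c.
have conn_uv : connect e u v.
  by apply: connect_trans (conn_c u) _; rewrite (sym_connect_sym e_sym).
have [[p [e_p p_v sz_p]] min_d] := gdistP conn_uv.
apply/eqP; rewrite eqn_leq; case: ifPn => [e_uv|n_uv].
  by rewrite d_gt0 (min_d [:: v]) //= e_uv.
apply/andP; split.
  have neq_uc : u != c.
    by apply: contraNneq n_uv => uc; rewrite uc univ_c // -uc eq_sym.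
  have neq_vc : v != c.
    by apply: contraNneq n_uv => vc; rewrite vc e_sym; apply: univ_c.
  by apply: (min_d [:: c; v]); rewrite //= e_sym !univ_c.
rewrite ltn_neqAle d_gt0 andbT -sz_p; apply: contraNneq n_uv => sz1.
by case: p e_p p_v sz1 {sz_p} => [|w []] //= /andP[e_uw _] <-.
Qed.

Lemma gdist_from_universal u v : universal u -> gdist e u v = (v != u).
Proof.
move=> univ_u; rewrite gdist_universal eq_sym.
by have [//|/univ_u->] := eqVneq v u.
Qed.

Lemma gdist_sym u v : gdist e u v = gdist e v u.
Proof. by rewrite !gdist_universal eq_sym e_sym. Qed.

Lemma universal_twin u v w : universal u -> universal v ->
  w != u -> w != v -> gdist e u w = gdist e v w.
Proof.
move=> univ_u univ_v neq_wu neq_wv.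
by rewrite !gdist_from_universal // neq_wu neq_wv.
Qed.

(** Two universal vertices are exchanged by an automorphism of the graph. *)
Lemma gdist_tperm u v : universal u -> universal v ->
  forall x y, gdist e (tperm u v x) (tperm u v y) = gdist e x y.
Proof.
move=> univ_u univ_v.
have dist_u := fun w => gdist_from_universal w univ_u.
have dist_v := fun w => gdist_from_universal w univ_v.
have inj := inj_eq (@perm_inj _ (tperm u v)).
move=> x y; case: (tpermP u v x) => [->|->|/eqP xu /eqP xv].
- by rewrite dist_v dist_u -(inj y u) tpermL.
- by rewrite dist_u dist_v -(inj y v) tpermR.
case: (tpermP u v y) => [->|->|//];
  by rewrite gdist_sym (gdist_sym x) dist_u dist_v xu xv.
Qed.

(** A minimum resolving set misses at most one universal vertex, and a missed
  one can be exchanged for another. *)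
Lemma universal_in_min_resolving g h :
  universal g -> universal h -> g != h ->
  exists W, [/\ resolving e W, #|W| = metric_dim e & c \in W].
Proof.
move=> univ_g univ_h neq_gh; have [[W resW cardW] _] := metric_dimP e.
have [u univ_u Wu] : exists2 u, universal u & u \in W.
  have twin_gh w := @universal_twin g h w univ_g univ_h.
  by case/orP: (twin_in_resolving twin_gh neq_gh resW); [exists g | exists h].
exists (tperm u c @: W); split.
- apply: resolving_imset resW; last exact: gdist_tperm.
  exact: injF_bij perm_inj.
- by rewrite card_imset //; apply: perm_inj.
- by apply/imsetP; exists u; rewrite ?tpermL.
Qed.

End Universal.

(** * Attaching pendant vertices at a universal vertex *)

Section Pendants.

Context {S T : finType} {eS : rel S} {eT : rel T} {f : S -> T} {c g h : S}.
Hypotheses (eS_sym : symmetric eS) (eT_sym : symmetric eT).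
Hypotheses (f_inj : injective f) (fE : forall u v, eT (f u) (f v) = eS u v).
Hypotheses (univ_c : @universal S eS c) (univ_g : @universal S eS g).
Hypotheses (univ_h : @universal S eS h).
Hypotheses (neq_gc : g != c) (neq_hc : h != c) (neq_gh : g != h).

Let P : {set T} := [set p | p \notin codom f].

Hypothesis pendantE : {in P, forall p t, eT p t = (t == f c)}.
Hypothesis P_gt1 : 1 < #|P|.

Let PN s : f s \notin P. Proof. by rewrite inE codom_f. Qed.

Variant vertex_spec : T -> Type :=
  | OldVertex s : vertex_spec (f s)
  | Pendant p of p \in P : vertex_spec p.

Let vertexP t : vertex_spec t.
Proof.
have [/codomP/sig_eqW[s ->]|Pt] := boolP (t \in codom f).
  exact: OldVertex.
by apply: Pendant; rewrite inE.
Qed.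

Let univ_fc : @universal T eT (f c).
Proof.
move=> t; case: (vertexP t) => [s|p Pp _].
  by rewrite (inj_eq f_inj) fE; apply: univ_c.
by rewrite eT_sym pendantE.
Qed.

Let distT := gdist_universal eT_sym univ_fc.
Let distT_sym := gdist_sym eT_sym univ_fc.
Let distS := gdist_universal eS_sym univ_c.

Let dist_old u v : gdist eT (f u) (f v) = gdist eS u v.
Proof. by rewrite distT distS (inj_eq f_inj) fE. Qed.

Let dist_pendant p t : p \in P ->
  gdist eT p t = (if t == p then 0 else if t == f c then 1 else 2)%N.
Proof. by move=> Pp; rewrite distT pendantE // eq_sym. Qed.

Let dist_old_pendant s p : p \in P ->
  gdist eT (f s) p = (if s == c then 1 else 2)%N.
Proof.
move=> Pp; rewrite distT_sym dist_pendant // (inj_eq f_inj).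
by have [Efs|] := eqVneq (f s) p; first by rewrite -Efs (negPf (PN s)) in Pp.
Qed.

(** At most one pendant is missed, and [c] does for the old vertices whatever
  the pendants did. *)
Lemma resolving_pendants_lower W :
  resolving eT W -> metric_dim eS + #|P| <= #|W| + 2.
Proof.
move=> resW; have [_ minS] := metric_dimP eS.
have leP : #|P| <= #|W :&: P| + 1.
  rewrite -(cardsID W P) setIC leq_add2l; apply/card_le1_eqP=> p q.
  rewrite !inE -/P => /andP[Wp Pp] /andP[Wq Pq].
  apply: contraNeq Wp; rewrite eq_sym => neq_pq.
  rewrite -[_ \in W]orbF -(negPf Wq).
  apply: twin_in_resolving _ neq_pq resW => w neq_wp neq_wq.
  rewrite !dist_pendant ?inE //.
  by rewrite (negPf neq_wp) (negPf neq_wq).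
have leS : metric_dim eS <= #|c |: f @^-1: W|.
  apply: minS; apply/resolvingP=> u v eq_uv.
  have eq_c : (u == c) = (v == c).
    have := eq_uv c (setU11 _ _).
    rewrite !(gdist_sym eS_sym univ_c _ c).
    rewrite !(gdist_from_universal eS_sym univ_c) //.
    by case: (u == c); case: (v == c).
  apply/f_inj/(resolvingP _ resW) => w; case: (vertexP w) => [s|p Pp] Ww.
    by rewrite !dist_old eq_uv // !inE Ww orbT.
  by rewrite !dist_old_pendant // eq_c.
have cardW : #|f @^-1: W| = #|W :\: P|.
  rewrite -(card_imset _ f_inj); apply: eq_card => t.
  apply/imsetP/setDP => [[s]|[Wt]].
    by rewrite inE => Wfs ->; rewrite PN.
  by case: (vertexP t) Wt => [s Wfs _|p -> //]; exists s; rewrite ?inE.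
have := leq_add leS leP; rewrite cardsU1 cardW => le1.
apply: leq_trans le1 _.
rewrite -(cardsID P W) addnA -addnA.
by case: (c \notin _) => /=; rewrite ?add1n ?add0n; lia.
Qed.

(** Trading [c] for all the pendants but one.  The last pendant is recognized
  by its distance 2 to [g] or [h]. *)
Lemma resolving_pendants_upper :
  exists2 W, resolving eT W & #|W| + 2 = metric_dim eS + #|P|.
Proof.
have [V [resV cardV Vc]] :=
  universal_in_min_resolving eS_sym univ_c univ_g univ_h neq_gh.
have [a [univ_a neq_ac Va]] :
    exists a, [/\ @universal S eS a, a != c & a \in V].
  have twin_gh w := @universal_twin _ _ eS_sym _ univ_c g h w univ_g univ_h.
  by case/orP: (twin_in_resolving twin_gh neq_gh resV); [exists g | exists h].
have [q [p0 [Pq Pp0 neq_qp0]]] := card_gt1P P_gt1.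
pose W := f @: (V :\ c) :|: P :\ p0.
have WP p : p \in P -> p != p0 -> p \in W.
  by move=> Pp neq; apply/setUP; right; apply/setD1P.
have Wf s : s \in V -> s != c -> f s \in W.
  by move=> Vs neq; apply/setUP; left; apply/imset_f/setD1P.
have Wq : q \in W by apply: WP.
exists W; last first.
  rewrite cardsU (_ : _ :&: _ = set0) ?cards0 ?subn0; last first.
    apply/setP=> t; rewrite in_set0; apply: contraTF isT.
    by case/setIP=> /imsetP[s _ ->] /setD1P[_]; rewrite (negPf (PN s)).
  rewrite card_imset // -cardV (cardsD1 c V) Vc (cardsD1 p0 P) Pp0; lia.
apply/resolvingP.
(* A selected vertex is recognized by its distance 0 to itself. *)
have self w t : w \in W ->
    {in W, forall w', gdist eT w w' = gdist eT t w'} -> w = t.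
  move=> Ww /(_ w Ww) E; apply/esym/eqP.
  by rewrite -(gdist_eq0 eT) -E gdist_eq0.
have oldNpendant s p : p \in P ->
    {in W, forall w, gdist eT (f s) w = gdist eT p w} -> f s = p.
  move=> Pp eq_sp; have [p_p0|neq_pp0] := eqVneq p p0; last first.
    by apply/esym/self => [|w Ww]; [apply: WP | rewrite eq_sp].
  have := eq_sp _ (Wf a Va neq_ac).
  rewrite dist_old dist_pendant // (inj_eq f_inj) (negPf neq_ac).
  rewrite (gdist_sym eS_sym univ_c) (gdist_from_universal eS_sym univ_c) //.
  have [Efa|_] := eqVneq (f a) p; first by rewrite -Efa (negPf (PN a)) in Pp.
  by case: (s != a).
move=> u v; case: (vertexP u) => [s|p Pp]; case: (vertexP v) => [t|r Pr] eq_uv.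
- have eq_c : (s == c) = (t == c).
    have := eq_uv q Wq; rewrite !dist_old_pendant //.
    by case: (s == c); case: (t == c).
  congr f; apply: (resolvingP _ resV) => w Vw.
  have [->|neq_wc] := eqVneq w c; last by rewrite -!dist_old eq_uv ?Wf.
  rewrite !(gdist_sym eS_sym univ_c _ c).
  by rewrite !(gdist_from_universal eS_sym univ_c) // eq_c.
- exact: oldNpendant.
- by apply/esym/oldNpendant => // w Ww; rewrite eq_uv.
have [p_p0|neq_pp0] := eqVneq p p0; last by apply: self => //; apply: WP.
have [r_p0|neq_rp0] := eqVneq r p0; first by rewrite p_p0 r_p0.
by apply/esym/self => [|w Ww]; [apply: WP | rewrite eq_uv].
Qed.

Lemma metric_dim_pendants : metric_dim eT + 2 = metric_dim eS + #|P|.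
Proof.
have [[W resW cardW] minT] := metric_dimP eT.
have [W' resW' cardW'] := resolving_pendants_upper.
apply/eqP; rewrite eqn_leq -{1}cardW' leq_add2r minT //=.
by rewrite -cardW resolving_pendants_lower.
Qed.

End Pendants.

(** * Power graphs *)

Lemma power_graph_generator {gT : finGroupType} {z : gT} :
  [set: gT] = <[z]> -> @universal gT (power_graph gT) z.
Proof.
move=> defG v neq_vz; apply/power_graphP; split.
  by apply/eqP; rewrite eq_sym.
left; have /cycleP[i ->] : v \in <[z]> by rewrite -defG inE.
by exists (i + #[z]); rewrite expgD expg_order mulg1 addn_gt0 order_gt0 orbT.
Qed.

Lemma power_graph_identity {gT : finGroupType} :
  @universal gT (power_graph gT) 1.
Proof.
move=> v /eqP neq_v1; apply/power_graphP; split; first exact: nesym.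
by right; exists #[v]; rewrite order_gt0 expg_order.
Qed.

Lemma power_graph_morph {aT rT : finGroupType}
    (f : {morphism [set: aT] >-> rT}) :
  'injm f -> forall u v, power_graph rT (f u) (f v) = power_graph aT u v.
Proof.
move=> /injmP f_inj u v; have inT w : w \in [set: aT] by rewrite inE.
have inj x y : f x = f y -> x = y by apply: f_inj.
have powE x y m : f x ^+ m = f y <-> x ^+ m = y.
  by rewrite -morphX //; split=> [/inj|->].
apply/power_graphP/power_graphP => -[neq pow]; split.
- by move=> Euv; apply: neq; rewrite Euv.
- by case: pow => -[m [m_gt0 /powE Em]]; [left | right]; exists m.
- by move/inj.
- by case: pow => -[m [m_gt0 /powE Em]]; [left | right]; exists m.
Qed.

(** The powers of an involution outside a subgroup [X] are itself and 1, and
  if it were a power of a different element [t], then [t] would have order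
  greater than 2 and so belong to [X], along with its powers. *)
Lemma power_graph_pendant {gT : finGroupType} {X : {group gT}} {p : gT} :
  {in ~: X, forall r : gT, r ^+ 2 = 1} -> p \notin X ->
  forall t, power_graph gT p t = (t == 1).
Proof.
move=> invol Xp t.
have powers (r : gT) m : r \notin X -> r ^+ m = r \/ r ^+ m = 1.
  move=> Xr; rewrite -(odd_double_half m) -mul2n expgD expgM invol ?inE //.
  by rewrite expg1n mulg1; case: (odd m); [left | right].
have p1 : p <> 1 by move=> p1; rewrite p1 group1 in Xp.
apply/idP/eqP => [/power_graphP[neq_pt [] [m [_ Em]]] | ->].
- by case: (powers p m Xp) => E; [case: neq_pt; rewrite -E|rewrite -Em].
- have [Xt|Xt] := boolP (t \in X).
    by rewrite -Em groupX in Xp.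
  by case: (powers t m Xt) => E; [case: neq_pt | case: p1]; rewrite -Em.
by rewrite power_graph_sym power_graph_identity //; apply/eqP.
Qed.

(** * Dihedral groups *)

(** The presentation writes the group as [<[x]> * <[y]>] with [#[x] <= n] and
  [#[y] <= 2]; as there are [2 * n] elements, [x] has order exactly [n] and the
  elements outside [<[x]>] are the reflections [x ^+ i * y]. *)
Lemma dihedral_rotations {n : nat} {gT : finGroupType} :
  1 < n -> [set: gT] \isog 'D_(2 * n) ->
  exists x : gT, [/\ #[x] = n, #|~: <[x]>| = n &
                     {in ~: <[x]>, forall r, r ^+ 2 = 1}].
Proof.
move=> n_gt1 isoD; have cardG : #|[set: gT]| = (2 * n)%N.
  by rewrite (card_isog isoD) mul2n card_dihedral // mul2n.
have := Grp_dihedral n_gt1; rewrite -mul2n.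
move=> /(_ _ [set: gT]%G); rewrite (isog_hom isoD).
move/esym; case/existsP=> -[x y] /= /eqP[defG xn y2 xy].
have Nxy : <[y]> \subset 'N(<[x]>).
  by rewrite cycle_subG; apply/normP; rewrite -cycleJ xy cycleV.
have defXY : <[x]> * <[y]> = [set: gT].
  by rewrite -defG norm_joinEr.
have le_x : #[x] <= n by rewrite dvdn_leq ?order_dvdn ?xn // ltnW.
have le_y : #[y] <= 2 by rewrite dvdn_leq ?order_dvdn ?y2.
have ord_x : #[x] = n.
  apply/eqP; rewrite eqn_leq le_x -(leq_pmul2l (isT : 0 < 2)) -cardG -defXY /=.
  rewrite (mulnC 2); apply: leq_trans (leq_mul (leqnn #[x]) le_y).
  by rewrite dvdn_leq ?dvdn_cardMg // muln_gt0 !order_gt0.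
exists x; split=> //.
  by rewrite cardsCs setCK -cardsT cardG -orderE ord_x mul2n -addnn addnK.
move=> r; rewrite inE => Xr.
have : r \in <[x]> * <[y]> by rewrite defXY inE.
case/mulsgP=> _ _ /cycleP[i ->] /cycleP[j ->] Er.
move: Xr; rewrite {}Er -(odd_double_half j) -mul2n (expgD y) expgM y2 expg1n.
rewrite mulg1; case: (odd j) => Xr; last by rewrite mulg1 mem_cycle in Xr.
have yV : y^-1 = y by apply/eqP; rewrite eq_invg_mul -expg2 y2.
(* The square is [x ^+ i * (x ^+ i) ^ y], and [y] inverts [x]. *)
by rewrite expg2 -mulgA -{1}yV -conjgE conjXg xy expgVn mulgV.
Qed.

Theorem theorem1p4 (n : nat) (dT zT : finGroupType) :
  (2 < n)%N ->
  [set: dT] \isog 'D_(2 * n)%N ->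
  cyclic [set: zT] -> #|[set: zT]| = n ->
  metric_dim (power_graph dT) = (metric_dim (power_graph zT) + n - 2)%N.
Proof.
move=> n_gt2 isoD cycZ cardZ; have /cyclicP[z defZ] := cycZ.
have ord_z : #[z] = n by rewrite orderE -defZ.
have [x [ord_x card_refl invol]] := dihedral_rotations (ltnW n_gt2) isoD.
have : [set: zT] \isog <[x]>.
  by rewrite isog_cyclic_card // cycle_cyclic cardZ -orderE ord_x eqxx.
case/isogP=> f injf im_f; have f_inj : injective f.
  by move=> u v; apply: (injmP injf); rewrite inE.
have codom_f t : (t \in codom f) = (t \in <[x]>).
  rewrite -im_f morphimEdom; apply/codomP/imsetP => -[s].
    by exists s; rewrite ?inE.
  by exists s.
have defP : [set p | p \notin codom f] = ~: <[x]>.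
  by apply/setP=> t; rewrite !inE codom_f.
have zV_neq : z != z^-1.
  rewrite eq_sym eq_invg_mul -expg2 -order_dvdn ord_z.
  by apply: contraL n_gt2 => /dvdn_leq; rewrite -leqNgt; apply.
have z1 : z != 1 by rewrite -order_eq1 ord_z; case: (n) n_gt2 => [|[]].
have defZV : [set: zT] = <[z^-1]> by rewrite cycleV.
have key := @metric_dim_pendants _ _ _ _ f 1 z z^-1
  (@power_graph_sym zT) (@power_graph_sym dT)
  f_inj (power_graph_morph injf) power_graph_identity
  (power_graph_generator defZ) (power_graph_generator defZV).
rewrite -{1}card_refl -defP -key ?addnK ?invg_eq1 //.
- move=> p Pp t; rewrite morph1; apply: power_graph_pendant invol _ t.
  by rewrite -codom_f inE in Pp *.
- by rewrite defP card_refl; apply: ltnW.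
Qed.
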